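(* Let $WPE(\mathfrak{G})$ be the subgroup generated by the mappings $T_1,\dots,T_n$ in the group of all bijections of the primary ellipsoid $PE(\mathfrak{G})$. Then $WPE(\mathfrak{G})$ is isomorphic to the Weyl group of the Lie algebra $\mathfrak{G}$.
   Context: Let $\mathfrak{G}$ be a complex semisimple Lie algebra of rank $n$, with a fixed Cartan subalgebra, root system $\Delta$, positive roots $\Delta^+$, and simple roots $\alpha_1,\dots,\alpha_n$. Let $A=(a_{ij})$ be the Cartan matrix. Identify $\alpha_i$ with the standard basis vector $e_i$ of $\mathbb{R}^n$. Equip $\mathbb{R}^n$ with a (positive definite) inner product $\langle\cdot,\cdot\rangle$ such that $2\langle e_i,e_j\rangle/\langle e_i,e_i\rangle=a_{ij}$ for all $i,j$. Let $\delta\in\mathbb{R}^n$ be the half-sum of all positive roots. The primary ellipsoid is $PE(\mathfrak{G})=\{x\in\mathbb{R}^n:\langle x,x-2\delta\rangle=0\}$. For $x=(x_1,\dots,x_n)\in PE(\mathfrak{G})$ and $i\in\{1,\dots,n\}$, let $h^x_i$ be the (unique) nonzero real number such that $(x_1,\dots,x_{i-1},x_i+h^x_i,x_{i+1},\dots,x_n)\in PE(\mathfrak{G})$, if such a number exists, and $h^x_i=0$ otherwise. The mapping $T_i:PE(\mathfrak{G})\to PE(\mathfrak{G})$ is defined by $T_i(x)=(x_1,\dots,x_{i-1},x_i+h^x_i,x_{i+1},\dots,x_n)$; each $T_i$ is an involution. *)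

(* Defs.v *)
From HB Require Import structures.
From mathcomp Require Import all_boot all_order all_algebra.
From mathcomp Require Import complex.
From mathcomp Require Import mathcomp_extra boolp classical_sets functions.
From mathcomp Require Import fsbigop reals.

Set Implicit Arguments.
Unset Strict Implicit.
Unset Printing Implicit Defensive.

Import Order.TTheory GRing.Theory Num.Theory.

Local Open Scope classical_set_scope.
Local Open Scope ring_scope.

Record sym (X : Type) := Sym {
  sym_fun :> X -> X;
  sym_inv : X -> X;
  symK : cancel sym_fun sym_inv;
  symVK : cancel sym_inv sym_fun }.

HB.instance Definition _ (X : Type) := gen_eqMixin (sym X).
HB.instance Definition _ (X : Type) := gen_choiceMixin (sym X).

Lemma sym_ext (X : Type) (s t : sym X) : s =1 t -> s = t.
Proof.
case: s t => [f f' fK f'K] [g g' gK g'K] /= /funext fg; subst g.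
have f'g' : f' = g' by apply/funext => x; rewrite -{1}(g'K x) fK.
by subst g'; congr Sym; exact: Prop_irrelevance.
Qed.

Section SymGroup.
Variable X : Type.
Implicit Types s t u : sym X.

Definition sym1 : sym X := @Sym X id id (fun=> erefl) (fun=> erefl).
Definition symV s : sym X := Sym (@symVK X s) (@symK X s).
Definition symM s t : sym X :=
  Sym (can_comp (@symK X s) (@symK X t)) (can_comp (@symVK X t) (@symVK X s)).

Lemma symMA : associative symM. Proof. by move=> s t u; apply: sym_ext. Qed.
Lemma sym1M : left_id sym1 symM. Proof. by move=> s; apply: sym_ext. Qed.
Lemma symM1 : right_id sym1 symM. Proof. by move=> s; apply: sym_ext. Qed.
Lemma symMV : left_inverse sym1 symV symM.
Proof. by move=> s; apply: sym_ext => x; exact: symK. Qed.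
Lemma symVM : right_inverse sym1 symV symM.
Proof. by move=> s; apply: sym_ext => x; exact: symVK. Qed.

HB.instance Definition _ := isGroup.Build (sym X) symMA sym1M symM1 symMV symVM.

Definition sym_involution (f : X -> X) (fK : involutive f) : sym X := Sym fK fK.

End SymGroup.

Definition is_subgroup (G : groupType) (A : set G) : Prop :=
  group_closed [pred x in A].

Definition generated_subgroup (G : groupType) (S : set G) : set G :=
  smallest (@is_subgroup G) S.

Definition isomorphic_subgroups (G K : groupType) (A : set G) (B : set K) :=
  exists2 f : G -> K, set_bij A B f & {in A &, {morph f : x y / (x * y)%g}}.

HB.mixin Record Vector_isLieAlgebra (K : fieldType) L of Vector K L := {
  lie : L -> L -> L;
  lie_linearl : forall y, linear (lie^~ y);
  lie_linearr : forall x, linear (lie x);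
  liexx : forall x, lie x x = 0;
  lie_jacobi : forall x y z,
    lie x (lie y z) + lie y (lie z x) + lie z (lie x y) = 0 }.

#[short(type="lieAlgType")]
HB.structure Definition LieAlgebra (K : fieldType) :=
  {L of Vector_isLieAlgebra K L & Vector K L}.

Section LieAlgebra.
Context {K : fieldType} {L : lieAlgType K}.
Implicit Types (U V I H : {vspace L}) (x y : L).

(* By bilinearity this is the span of all [x, y] with x in U and y in V. *)
Definition lie_prod U V : {vspace L} :=
  <<[seq lie x y | x <- vbasis U, y <- vbasis V]>>%VS.

Definition lie_ideal I := forall x y, y \in I -> lie x y \in I.

Definition derived_series U k : {vspace L} :=
  iter k (fun V => lie_prod V V) U.

Definition lie_solvable U := exists k, derived_series U k = 0%VS.

Definition lie_semisimple :=
  forall I, lie_ideal I -> lie_solvable I -> I = 0%VS.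

Definition lie_abelian U := {in U &, forall x y, lie x y = 0}.

Definition ad_diagonalizable x :=
  exists2 e : seq L, basis_of fullv e &
    {in e, forall v, exists a : K, lie x v = a *: v}.

(* Cartan subalgebras of a complex semisimple Lie algebra: the maximal abelian
   subalgebras all of whose elements are ad-semisimple. An abelian subspace is
   automatically a subalgebra. *)
Definition cartan_subalgebra H :=
  [/\ lie_abelian H,
      forall U, lie_abelian U -> (H <= U)%VS -> U = H &
      forall h, h \in H -> ad_diagonalizable h].

End LieAlgebra.

Arguments lie_semisimple {K} L.

Notation hdual K H := 'Hom(subvs_of H, K^o).

Section Roots.
Context {K : fieldType} {L : lieAlgType K} (H : {vspace L}).
Implicit Types a b : hdual K H.

Definition root_space a : set L :=
  [set x | forall h : subvs_of H, lie (vsval h) x = (a h : K) *: x].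

Definition roots : set (hdual K H) :=
  [set a | a != 0 /\ exists2 x : L, x != 0 & root_space a x].

Definition is_coroot a (h : subvs_of H) :=
  (exists x y : L,
    [/\ root_space a x, root_space (- a) y & vsval h = lie x y]) /\
  a h = 2.

(* For a root a of a semisimple Lie algebra, is_coroot a holds of exactly one
   element; the default value 0 is only there to make coroot total. *)
Definition coroot a : subvs_of H := xget 0 [set h | is_coroot a h].

Definition root_reflection a b : hdual K H := b - (b (coroot a) : K) *: a.

Lemma root_reflectionK a : involutive (root_reflection a).
Proof.
move=> b; rewrite /root_reflection /coroot.
case: xgetP => [h _ /= [_ ah2]|_]; last by rewrite !linear0 !scale0r !subr0.
rewrite !lfunE /= !lfunE /= ?lfunE /= ah2.
have -> : b h - b h *: (2 : K^o) = - b h.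
  by rewrite /GRing.scale /= mulr_natr mulr2n opprD addrA subrr sub0r.
by rewrite scaleNr opprK subrK.
Qed.

Definition root_reflection_sym a : sym (hdual K H) :=
  sym_involution (root_reflectionK a).

(* The group is taken inside all bijections of the dual of H; its elements are
   linear since the generators are. *)
Definition weyl_group : set (sym (hdual K H)) :=
  generated_subgroup [set root_reflection_sym a | a in roots].

Context {n : nat}.
Implicit Type al : n.-tuple (hdual K H).

Definition nat_comb al (b : hdual K H) :=
  exists c : 'I_n -> nat, b = \sum_(i < n) tnth al i *+ c i.

Definition simple_roots al :=
  [/\ basis_of fullv al,
      forall i, roots (tnth al i) &
      forall b, roots b -> nat_comb al b \/ nat_comb al (- b)].

Definition positive_roots al : set (hdual K H) :=
  [set b | roots b /\ nat_comb al b].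

Definition cartan_matrix al : 'M[K]_n :=
  \matrix_(i, j) (tnth al j (coroot (tnth al i)) : K).

End Roots.

Arguments weyl_group {K L} H.

Section HalfSum.
Context {R : realType} {L : lieAlgType R[i]} {H : {vspace L}} {n : nat}.
Variable al : n.-tuple (hdual R[i] H).

(* The embedding of R^n in the dual of H that identifies the i-th standard
   basis vector with the i-th simple root. *)
Definition simple_comb (x : 'rV[R]_n) : hdual R[i] H :=
  \sum_(i < n) (x 0 i)%:C%C *: tnth al i.

Definition half_sum : 'rV[R]_n :=
  2^-1 *: \sum_(x \in simple_comb @^-1` positive_roots al) x.

End HalfSum.

Section PrimaryEllipsoid.
Context {R : realType} {n : nat}.
Variables (ip : {dot 'rV[R]_n for idfun}) (d : 'rV[R]_n).
Implicit Types (x : 'rV[R]_n) (i : 'I_n).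

Definition cartan_compatible (A : 'M[R[i]]_n) :=
  forall i j : 'I_n, (2 * ip 'e_i 'e_j / ip 'e_i 'e_i)%:C%C = A i j.

Definition primary_ellipsoid : set 'rV[R]_n := [set x | ip x (x - 2 *: d) = 0].

Definition ellipsoid_step i x : R :=
  xget 0 [set h | h != 0 /\ primary_ellipsoid (x + h *: 'e_i)].

Definition ellipsoid_move i x : 'rV[R]_n := x + ellipsoid_step i x *: 'e_i.

Lemma ellipsoid_move_in i x :
  primary_ellipsoid x -> primary_ellipsoid (ellipsoid_move i x).
Proof.
rewrite /ellipsoid_move /ellipsoid_step => Px.
by case: xgetP => [h _ []//|_]; rewrite scale0r addr0.
Qed.

Lemma ellipsoid_shiftE i x h : primary_ellipsoid x -> h != 0 ->
  primary_ellipsoid (x + h *: 'e_i) <->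
  h = - (ip x 'e_i + ip 'e_i (x - 2 *: d)) / ip 'e_i 'e_i.
Proof.
move=> Px h0; have e_gt0 : 0 < ip 'e_i 'e_i.
  apply: neq0_dnorm_gt0; apply/eqP => /matrixP/(_ 0 i)/eqP.
  by rewrite !mxE !eqxx oner_eq0.
rewrite /primary_ellipsoid /= addrAC linearD /= linearZr_LR /=.
rewrite !linearDl /= !linearZl_LR /= Px add0r /=.
set B := ip x _; set C := ip _ (x - _); set q := ip _ _ in e_gt0 *.
have -> : h * C + h * (B + h * q) = h * (B + C + h * q).
  by rewrite -mulrDr addrA [C + B]addrC.
split=> [/eqP|->].
  rewrite mulf_eq0 (negPf h0) /= addrC addr_eq0 => /eqP <-.
  by rewrite mulfK ?gt_eqF.
by rewrite divfK ?gt_eqF // subrr mulr0.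
Qed.

Lemma ellipsoid_moveK i x :
  primary_ellipsoid x -> ellipsoid_move i (ellipsoid_move i x) = x.
Proof.
move=> Px; rewrite {2}/ellipsoid_move /ellipsoid_step.
case: xgetP => [h _ /= [h0 Ph]|noh].
  rewrite /ellipsoid_move /ellipsoid_step.
  have PNh : primary_ellipsoid (x + h *: 'e_i + - h *: 'e_i).
    by rewrite scaleNr addrK.
  suff -> : xget 0 [set k | k != 0 /\ primary_ellipsoid
      (x + h *: 'e_i + k *: 'e_i)] = - h by rewrite scaleNr addrK.
  apply: xget_unique => [|k /= [k0 /(ellipsoid_shiftE i Ph k0) ->]].
    by split; rewrite ?oppr_eq0.
  by apply/esym/(ellipsoid_shiftE i Ph); rewrite ?oppr_eq0.
by rewrite scale0r addr0 /ellipsoid_move /ellipsoid_step xgetPN ?scale0r ?addr0.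
Qed.

Definition ellipsoid_T i (x : primary_ellipsoid) : primary_ellipsoid :=
  exist _ (ellipsoid_move i (val x))
    (mem_set (ellipsoid_move_in i (set_mem (valP x)))).

Lemma ellipsoid_TK i : involutive (ellipsoid_T i).
Proof.
by move=> x; apply: val_inj; apply: ellipsoid_moveK; exact: set_mem (valP x).
Qed.

Definition ellipsoid_T_sym i : sym primary_ellipsoid :=
  sym_involution (ellipsoid_TK i).

Definition ellipsoid_group : set (sym primary_ellipsoid) :=
  generated_subgroup (range ellipsoid_T_sym).

End PrimaryEllipsoid.

Arguments primary_ellipsoid {R n} ip d.
Arguments ellipsoid_group {R n} ip d.

(* Main.v *)
Require Import Defs.
From HB Require Import structures.
From mathcomp Require Import all_boot all_order all_algebra.
From mathcomp Require Import complex.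
From mathcomp Require Import boolp classical_sets functions cardinality fsbigop reals.
From mathcomp Require Import finmap.
From mathcomp Require Import ring zify.

Set Implicit Arguments.
Unset Strict Implicit.
Unset Printing Implicit Defensive.

(* fingraph has a constant roots too. *)
Import Defs.
Import Order.TTheory GRing.Theory Num.Theory.

Local Open Scope classical_set_scope.
Local Open Scope ring_scope.

(** Translate the ellipsoid so that its centre, the half-sum d, becomes the
origin. The condition <x, x - 2d> = 0 says |x - d| = |d|, so PE is a sphere
around d, and T_i moves x along e_i to the other point of that sphere: T_i is
the orthogonal reflection in the hyperplane orthogonal to e_i, conjugated by
the translation ([ellipsoid_move_reflection]). When e_i is identified with the
simple root alpha_i, this reflection is the real form of the simple root
reflection s_i, because the two are governed by the same Cartan integers
([root_reflection_comb]).

Both groups are therefore generated by families indexed by the simple roots, and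
an element g of one corresponds to an element w of the other when
w (x - d) = g x - d on the sphere. Such a correspondence is a bijection as soon
as only the identity corresponds to the identity
([isomorphic_generated_subgroups]). In one direction this is clear. In the other
one, w is linear and the sphere contains d + c e_i for some c <> 0, so w fixes
every simple root; here the radius |d| must not vanish, and it does not because
the half-sum is a combination of simple roots with positive coefficients
([half_sum_neq0]; the sum is over a finite set by [finite_roots]).

What remains is that the simple reflections already generate the Weyl group
([weyl_group_simple]), and this is where the Lie algebra enters.
- A root with a coroot comes with an sl2-triple, and the representation theory of
  sl2 shows that its reflection permutes the roots ([sl2_reflection]).
- The inner product makes a positive root b have a positive product with some
  simple root alpha_i occurring in it; s_i then lowers the height of b unless b is
  a multiple of alpha_i. Hence simple reflections carry every root to a multiple
  of a simple root ([positive_root_descent]).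
- A reflection that permutes a finite spanning set is determined by the line that
  it negates ([reflection_unique]). So if g maps b into the line of alpha_i then
  g s_b g^-1 = s_i ([conj_root_reflection]), which places s_b in the group
  generated by the simple reflections.
The simple roots have coroots because the diagonal of the Cartan matrix is forced
to be 2; a root for which [coroot] takes its default value 0 has the identity for
reflection. *)

(** * Generated subgroups *)

Lemma is_subgroupP (G : groupType) (A : set G) :
  A 1%g -> (forall x y, A x -> A y -> A (x / y)%g) -> is_subgroup A.
Proof.
move=> A1 AB; split=> [|x y Ax Ay]; first exact: mem_set.
by apply: mem_set; apply: AB; apply: set_mem.
Qed.

Section Subgroups.
Variables (G : groupType).
Implicit Types (A : set G).

Lemma subgroup1 A : is_subgroup A -> A 1%g.
Proof. by case=> /set_mem. Qed.

Lemma subgroupB A x y : is_subgroup A -> A x -> A y -> A (x / y)%g.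
Proof. by case=> _ AB Ax Ay; apply: set_mem; apply: AB; apply: mem_set. Qed.

Lemma subgroupV A x : is_subgroup A -> A x -> A (x^-1)%g.
Proof. by move=> sA Ax; rewrite -div1g; apply: subgroupB => //; apply: subgroup1. Qed.

Lemma subgroupM A x y : is_subgroup A -> A x -> A y -> A (x * y)%g.
Proof. by move=> sA Ax Ay; rewrite -[y]invgK; apply: subgroupB => //; apply: subgroupV. Qed.

Lemma generated_subgroup_subgroup (S : set G) : is_subgroup (generated_subgroup S).
Proof.
apply: is_subgroupP => [A [sA _]|x y Sx Sy A [sA SA]]; first exact: subgroup1.
by apply: subgroupB => //; [apply: Sx | apply: Sy].
Qed.

Lemma mem_generated_subgroup (S : set G) x : S x -> generated_subgroup S x.
Proof. exact: sub_gen_smallest. Qed.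

Lemma generated_subgroup_min (S A : set G) :
  is_subgroup A -> S `<=` A -> generated_subgroup S `<=` A.
Proof. exact: smallest_sub. Qed.

End Subgroups.

(** The subgroup of G * K generated by the pairs (s i, t i) is contained in rho and
projects onto both generated groups. Since rho relates 1 to 1 only, this subgroup
is the graph of a bijection, which is automatically a morphism. *)
Lemma isomorphic_generated_subgroups (G K : groupType) (I : Type)
    (s : I -> G) (t : I -> K) (rho : G -> K -> Prop) :
  rho 1%g 1%g ->
  (forall g g' k k', rho g k -> rho g' k' -> rho (g / g')%g (k / k')%g) ->
  (forall i, rho (s i) (t i)) ->
  (forall k, rho 1%g k -> k = 1%g) ->
  (forall g, rho g 1%g -> g = 1%g) ->
  isomorphic_subgroups (generated_subgroup (range s))
    (generated_subgroup (range t)).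
Proof.
move=> r1 rB rs r1k rg1; set A := generated_subgroup _; set B := generated_subgroup _.
have sA : is_subgroup A by apply: generated_subgroup_subgroup.
have sB : is_subgroup B by apply: generated_subgroup_subgroup.
have AB g : A g -> exists2 k, B k & rho g k.
  move: g; apply: generated_subgroup_min => [|_ [i _ <-]].
    apply: is_subgroupP => [|g g' [k Bk gk] [k' Bk' gk']].
      by exists 1%g => //; apply: subgroup1.
    by exists (k / k')%g; [exact: (subgroupB sB)|apply: rB].
  by exists (t i) => //; apply: mem_generated_subgroup; exists i.
have BA k : B k -> exists2 g, A g & rho g k.
  move: k; apply: generated_subgroup_min => [|_ [i _ <-]].
    apply: is_subgroupP => [|k k' [g Ag gk] [g' Ag' gk']].
      by exists 1%g => //; apply: subgroup1.
    by exists (g / g')%g; [exact: (subgroupB sA)|apply: rB].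
  by exists (s i) => //; apply: mem_generated_subgroup; exists i.
have rho_inj g k k' : rho g k -> rho g k' -> k = k'.
  by move=> gk gk'; apply/divg1_eq/r1k; rewrite -(divgg g); apply: rB.
have rho_inj' g g' k : rho g k -> rho g' k -> g = g'.
  by move=> gk gk'; apply/divg1_eq/rg1; rewrite -(divgg k); apply: rB.
have rM g g' k k' : rho g k -> rho g' k' -> rho (g * g')%g (k * k')%g.
  move=> gk gk'; rewrite -[g']invgK -[k']invgK; apply: (rB) => //.
  by rewrite -[(g'^-1)%g]div1g -[(k'^-1)%g]div1g; apply: (rB).
pose f g := xget 1%g [set k | B k /\ rho g k].
have fP g : A g -> B (f g) /\ rho g (f g).
  by move=> /AB [k Bk gk]; apply: (@xgetI _ 1%g [set k | B k /\ rho g k] k).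
exists f; last first.
  move=> g g' /set_mem Ag /set_mem Ag'; have [_ fg] := fP _ Ag.
  have [_ fg'] := fP _ Ag'; have [_ fgg'] := fP _ (subgroupM sA Ag Ag').
  by apply: rho_inj fgg' _; apply: rM.
split=> [g /fP[]//|g g' /set_mem/fP[_ fg] /set_mem/fP[_ fg'] e|k Bk].
  by apply: rho_inj' fg _; rewrite e.
have [g Ag gk] := BA k Bk; exists g => //.
by have [_ fg] := fP g Ag; apply: rho_inj fg gk.
Qed.

(** * Eigenvalues and sl2-triples *)

Lemma finite_poly_roots (F : idomainType) (p : {poly F}) :
  p != 0 -> finite_set [set a | root p a].
Proof.
move=> p0; apply: contrapT => inf.
have [X /= Xp] := infinite_set_fset (size p) inf.
rewrite leqNgt => /negP; apply; apply: max_poly_roots => //.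
by apply/allP => a /Xp.
exact: fset_uniq.
Qed.

Lemma finite_eigenvalues (F : fieldType) (V : vectType F) (f : {linear V -> V}) :
  finite_set [set a : F | exists2 v, v != 0 & f v = a *: v].
Proof.
pose e := vbasis (fullv : {vspace V}).
have eb : basis_of fullv e := vbasisP _.
pose M := passmx.mxof e e (linfun f).
have M0 : char_poly M != 0 by apply: monic_neq0; apply: char_poly_monic.
apply: sub_finite_set (finite_poly_roots M0) => a [v v0 fv] /=.
rewrite -eigenvalue_root_char; apply/eigenvalueP; exists (passmx.rVof e v).
   by rewrite -passmx.rVof_app // lfunE /= fv; apply/rowP => i; rewrite !mxE linearZ.
by rewrite passmx.rVof_eq0.
Qed.

Lemma ladder_eigen (K : fieldType) (V : vectType K) (f h : {linear V -> V})
    (c m : K) (v : V) :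
  (forall w, h (f w) = f (h w) + c *: f w) -> h v = m *: v ->
  forall k, h (iter k f v) = (m + c *+ k) *: iter k f v.
Proof.
move=> hf hv; elim=> [|k IH] /=; first by rewrite addr0.
by rewrite hf IH linearZ /= -scalerDl mulrSr addrA.
Qed.

(** The iterates of f on v are eigenvectors of h with distinct eigenvalues, of which
there are only finitely many. *)
Lemma ladder_stops (K : numFieldType) (V : vectType K) (f h : {linear V -> V})
    (c m : K) (v : V) :
  c != 0 -> (forall w, h (f w) = f (h w) + c *: f w) ->
  v != 0 -> h v = m *: v ->
  exists2 p, (forall k, (k <= p)%N -> iter k f v != 0) & iter p.+1 f v = 0.
Proof.
move=> c0 hf v0 hv; have hk := ladder_eigen hf hv.
have [k fk] : exists k, iter k f v == 0.
  apply: contrapT => nz.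
  have fin := finite_eigenvalues h.
  have [] := infinite_nat; apply: (@sub_finite_set _ _
    [set k | exists2 v, v != 0 & h v = (m + c *+ k) *: v]) => [k _ /=|].
    by exists (iter k f v) => //; apply/negP => fk; apply: nz; exists k.
  apply: (@finite_preimage _ _ _ (fun k => m + c *+ k)) fin => //.
  by move=> i j _ _ /addrI /(mulrIn c0).
have [p fp minp] := ex_minnP (ex_intro (fun k => iter k f v == 0) k fk).
case: p fp minp => [|p] fp minp; first by rewrite /= (negPf v0) in fp.
exists p; last exact/eqP.
by move=> j jp; apply/negP => /minp; rewrite ltnNge jp.
Qed.

(** Applying x to v as long as the result is nonzero gives a primitive vector u, of
weight l = m + 2 p. From u, the identity x y^(k+1) u = (k+1) (l - k) y^k u and the
termination of the y-string at some N force l = N. *)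
Lemma sl2_string (K : numFieldType) (V : vectType K) (x y h : {linear V -> V})
    (m : K) (v : V) :
  (forall w, x (y w) = y (x w) + h w) ->
  (forall w, h (x w) = x (h w) + 2 *: x w) ->
  (forall w, h (y w) = y (h w) - 2 *: y w) ->
  v != 0 -> h v = m *: v ->
  exists p N : nat, m = N%:R - 2 * p%:R /\
    forall k, (k <= N)%N -> iter k y (iter p x v) != 0.
Proof.
move=> xy hx hy v0 hv.
have two0 : (2 : K) != 0 by rewrite pnatr_eq0.
have Ntwo0 : (- 2 : K) != 0 by rewrite oppr_eq0.
have hy' w : h (y w) = y (h w) + (- 2) *: y w by rewrite hy scaleNr.
have [p xp0 xp] := ladder_stops two0 hx v0 hv.
set u := iter p x v in xp0 xp.
have u0 : u != 0 by apply: xp0.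
have hu : h u = (m + 2 *+ p) *: u by apply: ladder_eigen.
have [N yN0 yN] := ladder_stops Ntwo0 hy' u0 hu.
set l := m + 2 *+ p in hu *.
have xyk k : x (iter k.+1 y u) = (k.+1%:R * (l - k%:R)) *: iter k y u.
  elim: k => [|k IH]; first by rewrite /= xy [x u]xp linear0 add0r mul1r subr0.
  rewrite [iter k.+2 y u]/= xy -/(iter k.+1 y u) IH linearZ /= -/(iter k.+1 y u).
  rewrite (ladder_eigen hy' hu k.+1) -scalerDl; congr (_ *: _).
  by rewrite -mulr_natr -natr1 [in RHS]mulrS; ring.
exists p, N; split=> //.
have := xyk N; rewrite -/(iter N.+1 y u) yN linear0 => /esym/eqP.
rewrite scaler_eq0 (negPf (yN0 _ (leqnn N))) orbF mulf_eq0 pnatr_eq0 /=.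
by rewrite subr_eq0 => /eqP <-; rewrite /l -mulr_natr; ring.
Qed.

(** * Root spaces and root strings *)

HB.instance Definition _ (K : fieldType) (L : lieAlgType K) (x : L) :=
  GRing.isLinear.Build K L L *:%R (lie x) (lie_linearr x).

Section Weights.
Variables (K : numFieldType) (L : lieAlgType K) (H : {vspace L}).
Implicit Types (x y z : L) (a b : hdual K H) (h : subvs_of H).

Lemma lieDl x y z : lie (x + y) z = lie x z + lie y z.
Proof. by have := lie_linearl z 1 x y; rewrite !scale1r. Qed.

Lemma lieC x y : lie x y = - lie y x.
Proof.
apply/eqP; rewrite -addr_eq0; have := liexx (x + y).
by rewrite lieDl !linearD /= !liexx add0r addr0 => ->.
Qed.

Lemma lieNl x y : lie (- x) y = - lie x y.
Proof. by rewrite lieC linearN opprK -lieC. Qed.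

Lemma lieZl (c : K) x y : lie (c *: x) y = c *: lie x y.
Proof. by rewrite lieC linearZ /= -scalerN -lieC. Qed.

Lemma lie_derivation x y z : lie x (lie y z) = lie (lie x y) z + lie y (lie x z).
Proof.
have /eqP := lie_jacobi x y z; rewrite -addrA addr_eq0 => /eqP ->.
by rewrite (lieC (lie x y)) (lieC x z) [lie y (- _)]linearN opprD addrC.
Qed.

Lemma root_spaceD a b x y :
  root_space a x -> root_space b y -> root_space (a + b) (lie x y).
Proof.
move=> ax bY h; by rewrite lie_derivation ax bY lfunE /= linearZ /= scalerDl lieZl.
Qed.

Lemma root_space_iter a b x y k : root_space a x -> root_space b y ->
  root_space (a + b *+ k) (iter k (lie y) x).
Proof.
move=> ax bY; elim: k => [|k IH]; first by rewrite mulr0n addr0.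
by rewrite mulrSr addrA addrC; apply: root_spaceD.
Qed.

(** For a weight vector v of weight a, put m = a(h). The string lemma gives
m = N - 2 p, and y^(N-p) x^p v is a nonzero vector of weight
a + p b - (N - p) b = a - m b, provided that p <= N. When N < p, m is negative, and
the same argument applies to the triple (y, x, -h), for which the weight of v
is - m. *)
Lemma sl2_reflection b (x y : L) h a : root_space b x -> root_space (- b) y ->
  vsval h = lie x y -> b h = 2 -> roots a -> roots (a - (a h : K) *: b).
Proof.
move=> bx bY hxy bh2 [a0 [v v0 av]]; split.
  apply: contra_neq a0 => /eqP; rewrite subr_eq0 => /eqP ab.
  have := congr1 (fun c : hdual K H => c h) ab.
  rewrite /= lfunE /= bh2 => /eqP; rewrite -subr_eq0 /GRing.scale /=.
  have -> : (a h : K) - (a h : K) * 2 = - a h by ring.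
  by rewrite oppr_eq0 => /eqP ah0; rewrite ab ah0 scale0r.
have Nh : - (vsval h) = lie y x by rewrite lieC -hxy.
have [] := @sl2_string K L (lie x) (lie y) (lie (vsval h)) (a h) v.
- by move=> w /=; rewrite lie_derivation -hxy addrC.
- by move=> w /=; rewrite lie_derivation bx bh2 lieZl addrC.
- move=> w /=; rewrite lie_derivation bY lfunE /= bh2 scaleNr lieNl lieZl.
  by rewrite addrC.
- exact: v0.
- exact: av.
move=> p [N [ahE nz]].
have [pN|Np] := leqP p N.
  exists (iter (N - p) (lie y) (iter p (lie x) v)); first by rewrite nz ?leq_subr.
  have -> : a - (a h : K) *: b = a + b *+ p + (- b) *+ (N - p).
    rewrite ahE mulNrn -!scaler_nat -addrA -scalerBl natrB //; congr (_ + _).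
    by rewrite -scaleNr; congr (_ *: _); ring.
  by do 2?apply: root_space_iter.
have [] := @sl2_string K L (lie y) (lie x) (lie (- vsval h)) (- a h) v.
- by move=> w /=; rewrite lie_derivation -Nh addrC.
- move=> w /=; rewrite lieNl lie_derivation bY lfunE /= bh2 scaleNr lieNl.
  by rewrite opprD opprK lieNl lieZl addrC linearN.
- move=> w /=; rewrite lieNl lie_derivation bx bh2 lieZl.
  by rewrite lieNl opprD addrC linearN.
- exact: v0.
- by rewrite /= lieNl av scaleNr.
move=> q [M [NahE nz']].
(* N - 2 p = - (M - 2 q), hence M = 2 q + (2 p - N) >= 2 q. *)
have qM : (q <= M)%N.
  have : (M%:R + N%:R : K) = 2 * (p%:R + q%:R).
    by move/eqP: NahE; rewrite ahE eq_sym subr_eq => /eqP ->; ring.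
  rewrite -!natrD -natrM => /eqP; rewrite eqr_nat => /eqP.
  by lia.
exists (iter (M - q) (lie x) (iter q (lie y) v)); first by rewrite nz' ?leq_subr.
have -> : a - (a h : K) *: b = a + (- b) *+ q + b *+ (M - q).
  rewrite -scaleNr NahE mulNrn -!scaler_nat -addrA -scaleNr -scalerDl natrB //.
  by congr (_ + _ *: _); ring.
by do 2?apply: root_space_iter.
Qed.

(** A root is determined by its values on a basis of H, and each of these is an
eigenvalue of the adjoint action of a basis vector. *)
Lemma finite_roots : finite_set (@roots K L H).
Proof.
pose e := vbasis (fullv : {vspace subvs_of H}).
pose S (i : 'I_(\dim (fullv : {vspace subvs_of H}))) :=
  [set c : K | exists2 v, v != 0 & lie (vsval (tnth e i)) v = c *: v].
have finS i : finite_set (S i) := finite_eigenvalues _.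
pose X := fset_set (\bigcup_i S i).
have SX i c : S i c -> c \in X.
  move=> Sc; rewrite in_fset_set; last exact: bigcup_finite.
  by apply: mem_set; exists i.
pose F a := [ffun i => insub (a (tnth e i) : K) : option X].
have finF : finite_set (F @` (@roots K L H)).
  exact: finite_finset.
move: finF; rewrite (@eq_finite_set _ _ _ (@roots K L H)) //.
apply: inj_card_eq => a b /set_mem[_ [x x0 ax]] /set_mem[_ [y y0 by_]] Fab.
have eab i : a (tnth e i) = b (tnth e i).
  have := congr1 (fun f : {ffun _ -> option X} => omap val (f i)) Fab.
  rewrite !ffunE !insubT => [||_ _ /= [] //]; apply: (SX i).
    by exists x.
  by exists y.
apply/lfunP => h; rewrite (coord_vbasis (memvf h)) !linear_sum.
by apply: eq_bigr => i _; rewrite !linearZ /=; have := eab i; rewrite (tnth_nth 0) => ->.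
Qed.

End Weights.

(** * Reflections that permute the roots *)

(** Elements of [sym V] are bundled as bijections only, so linearity is carried as a
proposition; these lemmas give access to its usual consequences. *)
Lemma linear_prop0 (K : pzRingType) (V W : lmodType K) (u : V -> W) :
  linear u -> u 0 = 0.
Proof. by move=> lu; have := lu (-1) 0 0; rewrite !scaleN1r !addNr. Qed.

Lemma linear_propZ (K : pzRingType) (V W : lmodType K) (u : V -> W) c v :
  linear u -> u (c *: v) = c *: u v.
Proof. by move=> lu; have := lu c v 0; rewrite (linear_prop0 lu) !addr0. Qed.

Lemma linear_propN (K : pzRingType) (V W : lmodType K) (u : V -> W) v :
  linear u -> u (- v) = - u v.
Proof. by move=> lu; rewrite -!scaleN1r linear_propZ. Qed.

Lemma linear_basis_eq (K : fieldType) (V W : vectType K) n (e : n.-tuple V)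
    (s t : V -> W) :
  basis_of fullv e -> linear s -> linear t ->
  (forall i, s (tnth e i) = t (tnth e i)) -> s =1 t.
Proof.
move=> eb ls lt st v.
pose s' : {linear V -> W} := HB.pack s (GRing.isLinear.Build _ _ _ _ s ls).
pose t' : {linear V -> W} := HB.pack t (GRing.isLinear.Build _ _ _ _ t lt).
rewrite -[s v]/(s' v) -[t v]/(t' v) (coord_basis eb (memvf v)) !linear_sum.
apply: eq_bigr => i _; rewrite !linearZ -tnth_nth; congr (_ *: _).
exact: st.
Qed.

(** The composite s t has the form v |-> v + c(v) a and fixes a, so its k-th iterate
moves v to v + k c(v) a. If v lies in the finite stable set Phi then these points cannot be
all distinct, so c(v) = 0. *)
Lemma reflection_unique (K : numFieldType) (V : lmodType K) (Phi : set V) (a : V)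
    (s t : V -> V) (f g : V -> K) :
  finite_set Phi -> a != 0 -> linear s -> linear t ->
  (forall v, s v = v - f v *: a) -> (forall v, t v = v - g v *: a) ->
  s a = - a -> t a = - a ->
  (forall v, Phi v -> Phi (s v)) -> (forall v, Phi v -> Phi (t v)) ->
  forall v, Phi v -> s v = t v.
Proof.
move=> fin a0 ls lt sE tE sa ta sPhi tPhi v Phiv.
pose c := g v - f v; have [|c0] := eqVneq c 0.
  by move/subr0_eq => fg; rewrite sE tE fg.
have lin_line (u : V -> V) d w : linear u -> u a = - a ->
    u (w + d *: a) = u w - d *: a.
  by move=> lu ua; rewrite addrC lu ua scalerN addrC.
have stv k : iter k (s \o t) v = v + (c *+ k) *: a.
  elim: k => [|k /= ->]; first by rewrite scale0r addr0.
  rewrite lin_line // tE -addrA -opprD -scalerDl -scaleNr lin_line // sE.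
  rewrite -addrA -opprD -scalerDl; congr (_ + _); rewrite -scaleNr.
  by congr (_ *: _); rewrite mulrS /c; ring.
case: infinite_nat.
have <- : (fun k => v + (c *+ k) *: a) @^-1` Phi = [set: nat].
  apply/seteqP; split=> // k _ /=; rewrite -stv.
  by elim: k => //= k IH; apply/sPhi/tPhi.
apply: finite_preimage fin => i j _ _ /addrI/eqP.
by rewrite -subr_eq0 -scalerBl scaler_eq0 (negPf a0) orbF subr_eq0 => /eqP/(mulrIn c0).
Qed.

Section RootAutomorphisms.
Variables (K : numFieldType) (L : lieAlgType K) (H : {vspace L}).
Implicit Types (a b : hdual K H) (g : sym (hdual K H)).

(** The equivalence, rather than an implication, makes the property stable under
inversion. *)
Definition root_automorphism g :=
  linear g /\ forall a, roots (g a) <-> roots a.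

Lemma sym_mulVK g a : g (g^-1%g a) = a. Proof. exact: symVK. Qed.

Lemma root_automorphism_subgroup : is_subgroup root_automorphism.
Proof.
apply: is_subgroupP => [|g g' [lg rg] [lg' rg']]; first by split.
have gE v : (g / g')%g v = g ((g'^-1)%g v) by [].
split=> [c u v|a]; rewrite !gE; last by rewrite rg -rg' sym_mulVK.
by rewrite -lg; congr (g _); apply: (can_inj (symK g')); rewrite lg' !sym_mulVK.
Qed.

Lemma root_reflection_linear a : linear (@root_reflection K L H a).
Proof.
move=> c u v; rewrite /root_reflection !lfunE /= lfunE /= scalerDl scalerBr scalerA.
by rewrite opprD addrACA.
Qed.

Lemma root_reflection_self a : a (coroot a) = 2 -> root_reflection a a = - a.
Proof.
move=> a2; rewrite /root_reflection a2 scaler_nat mulr2n opprD addrA subrr.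
by rewrite sub0r.
Qed.

Lemma roots_neq0 a : roots a -> a != 0. Proof. by case. Qed.

Lemma coroot_neq0 a : coroot a != 0 -> is_coroot a (coroot a).
Proof. by rewrite /coroot; case: xgetP => [h _|_ /eqP]. Qed.

Lemma root_reflection_roots a b :
  is_coroot a (coroot a) -> roots b -> roots (root_reflection a b).
Proof. by case=> -[x [y [ax ay hxy]]] a2; apply: sl2_reflection ax ay hxy a2. Qed.

Lemma root_opp a : is_coroot a (coroot a) -> roots a -> roots (- a).
Proof.
move=> ca ra; rewrite -root_reflection_self; last by case: ca.
exact: root_reflection_roots.
Qed.

Lemma root_reflection_automorphism a :
  is_coroot a (coroot a) -> root_automorphism (root_reflection_sym a).
Proof.
move=> ca; split=> [|b]; first exact: root_reflection_linear.
split=> [rb|]; last exact: root_reflection_roots.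
by rewrite -[b](root_reflectionK a); apply: root_reflection_roots.
Qed.

(** The conjugate g s_b g^-1 sends v to v minus a multiple of g b, that is of a, and
it negates a and permutes the roots; so does s_a, and the roots span. *)
Lemma conj_root_reflection (n : nat) (al : n.-tuple (hdual K H)) g a b (c : K) :
  basis_of fullv al -> (forall i, roots (tnth al i)) ->
  root_automorphism g -> roots a -> is_coroot a (coroot a) ->
  roots b -> is_coroot b (coroot b) -> g b = c *: a ->
  root_reflection_sym b = (g^-1 * root_reflection_sym a * g)%g.
Proof.
move=> alb alr [lg rg] ra ca rb cb gb.
pose t := (g * root_reflection_sym b * g^-1)%g.
have tE v : t v = g (root_reflection b (g^-1%g v)) by [].
have c0 : c != 0.
  have := roots_neq0 (iffRL (rg b) rb).
  by rewrite gb; apply: contra_neq => ->; rewrite scale0r.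
have t_aut : root_automorphism t.
  have sA := root_automorphism_subgroup.
  apply: (subgroupB sA) => //; apply: (subgroupM sA) => //.
  exact: root_reflection_automorphism.
have ta : t a = - a.
  have -> : a = c^-1 *: g b by rewrite gb scalerA mulVf // scale1r.
  rewrite (linear_propZ _ _ t_aut.1) tE [(g^-1)%g _]symK.
  rewrite root_reflection_self; last by case: cb.
  by rewrite linear_propN // scalerN.
have tE' v : t v = v - ((g^-1%g v (coroot b) : K) * c) *: a.
  rewrite tE /root_reflection addrC -scaleNr lg gb scalerA mulNr sym_mulVK.
  by rewrite scaleNr addrC.
have -> : root_reflection_sym a = t.
  apply: sym_ext; apply: linear_basis_eq alb _ _ _.
  - exact: root_reflection_linear.
  - by case: t_aut.
  move=> i; apply: (@reflection_unique K _ _ a (root_reflection_sym a) t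
    (fun v => v (coroot a)) _ (finite_roots H) (roots_neq0 ra)) => //.
  - exact: root_reflection_linear.
  - by case: t_aut.
  - exact: tE'.
  - by apply: root_reflection_self; case: ca.
  - by move=> v; apply: root_reflection_roots.
  - by move=> v; case: t_aut => _ /(_ v) [].
by rewrite /t !mulgA mulVg mul1g mulgVK.
Qed.

End RootAutomorphisms.

(** * Simple roots and their inner product *)

Section SimpleCoordinates.
Variables (R : realType) (L : lieAlgType R[i]) (H : {vspace L}) (n : nat).
Variable al : n.-tuple (hdual R[i] H).
Implicit Types x y : 'rV[R]_n.

Local Notation e i := ('e_i : 'rV[R]_n).

Lemma simple_combD x y :
  simple_comb al (x + y) = simple_comb al x + simple_comb al y.
Proof.
rewrite /simple_comb -big_split; apply: eq_bigr => i _ /=.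
by rewrite mxE rmorphD scalerDl.
Qed.

Lemma simple_combZ (c : R) x : simple_comb al (c *: x) = c%:C%C *: simple_comb al x.
Proof.
rewrite /simple_comb scaler_sumr; apply: eq_bigr => i _ /=.
by rewrite mxE rmorphM scalerA.
Qed.

Lemma simple_comb_e i : simple_comb al (e i) = tnth al i.
Proof.
rewrite /simple_comb (bigD1 i) //= big1 ?addr0 => [|j ji].
  by rewrite mxE !eqxx scale1r.
by rewrite mxE (negPf ji) andbF scale0r.
Qed.

Lemma simple_comb_nat (c : 'I_n -> nat) :
  \sum_i tnth al i *+ c i = simple_comb al (\row_i (c i)%:R).
Proof. by apply: eq_bigr => i _; rewrite mxE rmorph_nat scaler_nat. Qed.

Lemma simple_comb_inj : basis_of fullv al -> injective (simple_comb al).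
Proof.
move=> alb x y xy; apply/rowP => i.
have alf : free al := basis_free alb.
have cE z : coord al i (simple_comb al z) = (z 0 i)%:C%C.
  rewrite /simple_comb linear_sum (bigD1 i) //= big1 ?addr0 => [|j ji].
    by rewrite linearZ /= (tnth_nth 0) coord_free // eqxx mulr1.
  by rewrite linearZ /= (tnth_nth 0) coord_free // (negPf ji) mulr0.
by have := congr1 (coord al i) xy; rewrite !cE => /complexI.
Qed.

Variable ip : {dot 'rV[R]_n for idfun}.

Definition reflection_coef i x : R := 2 * ip (e i) x / ip (e i) (e i).

Lemma ipC x y : ip x y = ip y x.
Proof. by rewrite hermC expr0 mul1r. Qed.

Lemma ip_gt0 x : x != 0 -> 0 < ip x x.
Proof. exact: neq0_dnorm_gt0. Qed.

Lemma e_neq0 i : e i != 0.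
Proof. by apply/eqP => /rowP/(_ i)/eqP; rewrite !mxE !eqxx oner_eq0. Qed.

Lemma ip_e_gt0 i : 0 < ip (e i) (e i). Proof. exact/ip_gt0/e_neq0. Qed.

Hypothesis al_simple : simple_roots al.
Hypothesis al_compat : cartan_compatible ip (cartan_matrix al).

Let alb : basis_of fullv al. Proof. by case: al_simple. Qed.
Let alr i : roots (tnth al i). Proof. by case: al_simple. Qed.

(** The diagonal entry of the Cartan matrix is 2, so [coroot] cannot take its default
value at a simple root. *)
Lemma simple_is_coroot i : is_coroot (tnth al i) (coroot (tnth al i)).
Proof.
apply: coroot_neq0; apply/eqP => c0.
have := al_compat i i; rewrite mxE c0 linear0 mulfK ?gt_eqF ?ip_e_gt0 //.
by move/eqP; rewrite rmorph_nat pnatr_eq0.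
Qed.

Lemma root_reflection_comb i x :
  root_reflection (tnth al i) (simple_comb al x) =
  simple_comb al (x - reflection_coef i x *: e i).
Proof.
rewrite -scaleNr simple_combD simple_combZ simple_comb_e rmorphN scaleNr.
congr (_ - _ *: _); rewrite /simple_comb sum_lfunE.
rewrite /reflection_coef {2}(row_sum_delta x) linear_sum mulr_sumr mulr_suml rmorph_sum.
apply: eq_bigr => j _; rewrite lfunE /= linearZ /=.
have := al_compat i j; rewrite mxE => <-.
rewrite [LHS]/GRing.scale /= -rmorphM; congr (_%:C)%C; ring.
Qed.

Let s i := root_reflection_sym (tnth al i).

Lemma simple_reflections_automorphism :
  generated_subgroup (range s) `<=` @root_automorphism _ L H.
Proof.
apply: generated_subgroup_min; first exact: root_automorphism_subgroup.
by move=> _ [i _ <-]; apply/root_reflection_automorphism/simple_is_coroot.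
Qed.

(** Induction on the height. Since <b, b> > 0, some alpha_i occurs in b with
<alpha_i, b> > 0, so the i-th coefficient of the root s_i b is smaller than that of
b while the others agree. If s_i b is positive then its height is smaller. If it
is negative then the unchanged coefficients vanish, and b is a multiple of
alpha_i. *)
Lemma positive_root_descent (c : 'I_n -> nat) :
  roots (simple_comb al (\row_i (c i)%:R)) ->
  exists2 g, generated_subgroup (range s) g &
    exists i (k : R[i]), g (simple_comb al (\row_i (c i)%:R)) = k *: tnth al i.
Proof.
have sW : is_subgroup (generated_subgroup (range s)).
  exact: generated_subgroup_subgroup.
have [N] := ubnP (\sum_i c i); elim: N c => // N IH c; rewrite ltnS => cN.
set x := \row_i _ => rx.
have x0 : x != 0.
  apply: contra_neq (roots_neq0 rx) => ->.
  by rewrite -(scale0r 0) simple_combZ scale0r.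
have [i ix] : exists i, 0 < x 0 i * ip (e i) x.
  apply: contrapT => nx; have := ip_gt0 x0; rewrite {1}(row_sum_delta x).
  rewrite linear_sumlz /= ltNge => /negP; apply; apply: sumr_le0 => i _.
  by rewrite linearZl_LR /= leNgt; apply/negP => ?; apply: nx; exists i.
have ci : 0 < (c i)%:R :> R.
  rewrite lt_neqAle ler0n andbT eq_sym.
  by apply: contraTneq ix; rewrite mxE => ->; rewrite mul0r ltxx.
have t0 : 0 < reflection_coef i x.
  apply: divr_gt0 (ip_e_gt0 i); apply: mulr_gt0 => //.
  by move: ix; rewrite mxE pmulr_rgt0.
have sx : roots (simple_comb al (x - reflection_coef i x *: e i)).
  rewrite -root_reflection_comb.
  exact: root_reflection_roots (simple_is_coroot i) _.
case: al_simple => _ _ /(_ _ sx) [] [d].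
  rewrite simple_comb_nat => /(simple_comb_inj alb) xd.
  have dc j : (d j)%:R = (c j)%:R - reflection_coef i x * (j == i)%:R :> R.
    by have /rowP/(_ j) := xd; rewrite !mxE eqxx /= => <-.
  have dN : (\sum_j d j < N)%N.
    apply: leq_trans cN; rewrite -(ltr_nat R) !natr_sum.
    rewrite (bigD1 i) // [ltRHS](bigD1 i) //= ltr_leD //.
      by rewrite dc eqxx mulr1 ltrBlDr ltrDl.
    by apply: ler_sum => j ji; rewrite dc (negPf ji) mulr0 subr0.
  move: sx; rewrite xd => sd; have [g Wg [j [k gk]]] := IH d dN sd.
  exists (g * s i)%g.
    by apply: (subgroupM sW) => //; apply: mem_generated_subgroup; exists i.
  exists j, k; rewrite -gk -xd.
  by rewrite -[(g * _)%g _]/(g (root_reflection _ _)) root_reflection_comb.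
rewrite simple_comb_nat -scaleN1r => xd; exists 1%g; first exact: (subgroup1 sW).
have {}xd : x - reflection_coef i x *: e i = - \row_j (d j)%:R.
  apply: (simple_comb_inj alb); rewrite -[- \row__ _]scaleN1r simple_combZ.
  by rewrite -xd scalerA rmorphN1 mulrNN mulr1 scale1r.
exists i, (c i)%:R; rewrite -[LHS]/(simple_comb al x) /simple_comb (bigD1 i) //=.
rewrite big1 => [|j ji]; first by rewrite addr0 mxE rmorph_nat.
suff -> : x 0 j = 0 by rewrite scale0r.
have /rowP/(_ j) := xd; rewrite !mxE eqxx (negPf ji) mulr0 subr0 => /eqP.
by rewrite -addr_eq0 -natrD pnatr_eq0 addn_eq0 => /andP[/eqP ->].
Qed.

(** A negative root b is handled through - b, which is a root because s_b is a
reflection that preserves the roots. *)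
Lemma weyl_group_simple : weyl_group H = generated_subgroup (range s).
Proof.
apply/seteqP; split; apply: generated_subgroup_min;
  try exact: generated_subgroup_subgroup.
  move=> _ [b rb <-].
  have sW : is_subgroup (generated_subgroup (range s)).
    exact: generated_subgroup_subgroup.
  have [c0|/coroot_neq0 cb] := eqVneq (coroot b) 0.
    suff -> : root_reflection_sym b = 1%g by exact: (subgroup1 sW).
    apply: sym_ext => v; rewrite /= /root_reflection c0 linear0.
    by rewrite scale0r subr0.
  have [g Wg [i [k gb]]] : exists2 g, generated_subgroup (range s) g &
      exists i (k : R[i]), g b = k *: tnth al i.
    case: al_simple => _ _ /(_ _ rb) [] [c].
      by rewrite simple_comb_nat => bc; rewrite bc in rb *; apply: positive_root_descent.
    rewrite simple_comb_nat => bc; have := root_opp cb rb; rewrite bc.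
    move/positive_root_descent => [g Wg [i [k gb]]]; exists g => //.
    exists i, (- k); rewrite scaleNr -gb -bc.
    have [lg _] := simple_reflections_automorphism Wg.
    by rewrite linear_propN // opprK.
  rewrite (conj_root_reflection alb alr (simple_reflections_automorphism Wg)
    (alr i) (simple_is_coroot i) rb cb gb).
  apply: (subgroupM sW) => //; apply: (subgroupM sW); first exact: (subgroupV sW).
  by apply: mem_generated_subgroup; exists i.
by move=> _ [i _ <-]; apply: mem_generated_subgroup; exists (tnth al i).
Qed.

(** Positive roots have nonnegative coordinates and the i-th simple root is among
them, so the i-th coordinate of the half-sum is positive. *)
Lemma half_sum_neq0 (i : 'I_n) : half_sum al != 0.
Proof.
have fin : finite_set (simple_comb al @^-1` positive_roots al).
  apply: finite_preimage => [x y _ _|]; first exact: simple_comb_inj.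
  by apply: sub_finite_set (finite_roots H) => b [].
apply/eqP => /rowP/(_ i)/eqP; rewrite /half_sum !mxE mulf_eq0 invr_eq0 pnatr_eq0 /=.
rewrite fsbig_finite //= summxE => /eqP.
have ge0 x : x \in fset_set (simple_comb al @^-1` positive_roots al) -> 0 <= x 0 i.
  rewrite in_fset_set // => /set_mem[_ [c]].
  by rewrite simple_comb_nat => /(simple_comb_inj alb) ->; rewrite mxE ler0n.
have ei : e i \in fset_set (simple_comb al @^-1` positive_roots al).
  rewrite in_fset_set //; apply: mem_set; split; first by rewrite simple_comb_e.
  exists (fun j => (j == i) : nat); rewrite simple_comb_nat; congr simple_comb.
  by apply/rowP => j; rewrite !mxE eqxx.
rewrite (big_fsetD1 (e i)) //= => /eqP; rewrite gt_eqF //; apply: ltr_wpDr.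
  by rewrite big_seq; apply: sumr_ge0 => x; rewrite inE => /andP[_ /ge0].
by rewrite mxE !eqxx ltr01.
Qed.

End SimpleCoordinates.

(** * The primary ellipsoid as a sphere *)

Section Ellipsoid.
Variables (R : realType) (n : nat) (ip : {dot 'rV[R]_n for idfun}) (d : 'rV[R]_n).

Lemma ellipsoidP x : primary_ellipsoid ip d x <-> ip (x - d) (x - d) = ip d d.
Proof.
have -> : primary_ellipsoid ip d x = (ip (x - d) (x - d) - ip d d = 0).
  rewrite /primary_ellipsoid /= linearBr linearZ /= !linearBl /= !linearBr /=.
  by rewrite (ipC ip d x); congr (_ = _); ring.
by split=> [/subr0_eq//|->]; rewrite subrr.
Qed.

(** The second point of the line x + R e_i on the sphere is the mirror image of x.
When the line is tangent there is no such point, and the reflection fixes x as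
well. *)
Lemma ellipsoid_move_reflection i x : primary_ellipsoid ip d x ->
  ellipsoid_move ip d i x - d = (x - d) - reflection_coef ip i (x - d) *: 'e_i.
Proof.
move=> Px; rewrite /ellipsoid_move addrAC -scaleNr; congr (_ + _ *: _).
have cE : - reflection_coef ip i (x - d) =
    - (ip x 'e_i + ip 'e_i (x - 2 *: d)) / ip 'e_i 'e_i.
  rewrite /reflection_coef -mulNr (ipC ip x); congr (- _ / _).
  by rewrite !linearB /= linearZ /=; ring.
rewrite /ellipsoid_step; case: xgetP => [h _ /= [h0 Ph]|no].
  by rewrite cE; apply/(ellipsoid_shiftE i Px).
apply/esym/eqP; apply: contrapT => /negP c0; apply: (no _ (conj c0 _)).
exact/(ellipsoid_shiftE i Px c0).
Qed.

Lemma ellipsoid_axis_point i : d != 0 ->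
  exists2 c, c != 0 & primary_ellipsoid ip d (d + c *: 'e_i).
Proof.
move=> d0; exists (Num.sqrt (ip d d / ip 'e_i 'e_i)).
  by rewrite gt_eqF // sqrtr_gt0 divr_gt0 ?ip_e_gt0 ?ip_gt0.
apply/ellipsoidP; rewrite addrAC subrr add0r linearZ /= linearZl_LR /= mulrA.
rewrite -expr2 sqr_sqrtr; last by rewrite ltW // divr_gt0 ?ip_e_gt0 ?ip_gt0.
by rewrite divfK // gt_eqF ?ip_e_gt0.
Qed.

End Ellipsoid.

Theorem theorem3p1 (R : realType) (L : lieAlgType R[i]) (H : {vspace L})
    (n : nat) (al : n.-tuple (hdual R[i] H)) (ip : {dot 'rV[R]_n for idfun}) :
  lie_semisimple L ->
  cartan_subalgebra H ->
  simple_roots al ->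
  cartan_compatible ip (cartan_matrix al) ->
  isomorphic_subgroups (ellipsoid_group ip (half_sum al)) (weyl_group H).
Proof.
move=> _ _ als alc; rewrite (weyl_group_simple als alc) /ellipsoid_group.
have [alb alr _] := als.
set d := half_sum al.
apply: (@isomorphic_generated_subgroups (sym (primary_ellipsoid ip d))
  (sym (hdual R[i] H)) 'I_n _ _ (fun g w => linear w /\
  forall x : primary_ellipsoid ip d,
    w (simple_comb al (val x - d)) = simple_comb al (val (g x) - d))).
- by split.
- move=> g g' w w' [lw gw] [lw' gw']; split=> [c u v|x].
    rewrite -[LHS]/(w (w'^-1%g _)) -[(w / w')%g u]/(w (w'^-1%g u)).
    rewrite -[(w / w')%g v]/(w (w'^-1%g v)) -lw; congr (w _).
    by apply: (can_inj (symK w')); rewrite lw' !sym_mulVK.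
  rewrite -[(g / g')%g x]/(g (sym_inv g' x)) -gw.
  rewrite -[LHS]/(w (sym_inv w' _)); congr (w _); apply: (can_inj (symK w')).
  by rewrite symVK gw' symVK.
- move=> i; split=> [|x]; first exact: root_reflection_linear.
  rewrite -[LHS]/(root_reflection _ _) (root_reflection_comb alc).
  by rewrite /= ellipsoid_move_reflection //; apply: set_mem (valP x).
- (* The sphere meets every axis through its centre away from the centre. *)
  move=> w [lw gw]; apply: sym_ext; apply: (linear_basis_eq alb) => // i.
  have [c c0 Pc] := ellipsoid_axis_point ip i (half_sum_neq0 als i).
  have := gw (SigSub (mem_set Pc)); rewrite /= addrAC subrr add0r.
  rewrite simple_combZ simple_comb_e => wc.
  have c0' : c%:C%C != 0 :> R[i] by rewrite fmorph_eq0.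
  by apply: (scalerI c0'); rewrite -[RHS]wc linear_propZ.
move=> g [_ gw]; apply: sym_ext => x; apply: val_inj => /=.
by have /= := gw x; move/(simple_comb_inj alb)/addIr => <-.
Qed.
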